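(* For $a,b>0$ let $X_{a,b}\sim\mathrm{Beta}(a,b)$. (i) For $a,b>1$ let $\mathrm{mode}(X_{a,b})$ be the mode of $\mathrm{Beta}(a,b)$. Then the mapping $(a,b)\mapsto\mathbb{P}(X_{a,b}>\mathrm{mode}(X_{a,b}))$, defined for $a,b>1$, is decreasing in $a$ and increasing in $b$. (ii) For $a,b<1$ let $\mathrm{antimode}(X_{a,b})$ be the anti-mode of $\mathrm{Beta}(a,b)$. Then the mapping $(a,b)\mapsto\mathbb{P}(X_{a,b}>\mathrm{antimode}(X_{a,b}))$, defined for $0<a,b<1$, is increasing in $a$ and decreasing in $b$.
   Context: For $a,b>0$, $\mathrm{Beta}(a,b)$ is the distribution on $[0,1]$ with density $x^{a-1}(1-x)^{b-1}/\mathrm{B}(a,b)$ for $x\in(0,1)$, where $\mathrm{B}(a,b)=\int_0^1 y^{a-1}(1-y)^{b-1}\,dy$. The mode (resp. anti-mode) is the unique maximizer (resp. unique minimizer) of this continuous density; for $a,b>1$ (resp. $a,b<1$) it exists and equals $(a-1)/(a+b-2)$. ''Increasing'' and ''decreasing'' are meant in the weak (non-strict) sense, in one parameter with the other fixed. *)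

(* Defs.v *)
From HB Require Import structures.
From mathcomp Require Import all_boot all_order all_algebra.
From mathcomp Require Import all_classical all_reals all_analysis.
Set Implicit Arguments.
Unset Strict Implicit.
Unset Printing Implicit Defensive.
Import Order.TTheory GRing.Theory Num.Theory.
Import numFieldNormedType.Exports.
Local Open Scope classical_set_scope.
Local Open Scope ring_scope.

(* MathComp-Analysis's beta_fun, beta_pdf and beta_prob only take natural
   parameters; the following versions have real parameters. *)

Definition Beta_kernel {R : realType} (a b x : R) : R :=
  x `^ (a - 1) * (1 - x) `^ (b - 1).

Definition Beta_fun {R : realType} (a b : R) : R :=
  \int[lebesgue_measure]_(y in `]0, 1[) Beta_kernel a b y.

(* The density is set to 0 at the endpoints as well as outside of [0, 1]: the
   endpoints are Lebesgue-null, and the kernel may diverge there. *)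
Definition Beta_pdf {R : realType} (a b : R) : R -> R :=
  (fun x => Beta_kernel a b x / Beta_fun a b) \_ `]0, 1[.

Definition has_Beta_law {R : realType} (d : measure_display)
    (T : measurableType d) (P : probability T R) (X : {RV P >-> R})
    (a b : R) : Prop :=
  forall V : set R, measurable V ->
    distribution P X V = (\int[lebesgue_measure]_(x in V) (Beta_pdf a b x)%:E)%E.

Definition unique_maximizer {R : realType} (A : set R) (f : R -> R) (m : R) :
    Prop :=
  A m /\ forall x, A x -> x != m -> f x < f m.

Definition unique_minimizer {R : realType} (A : set R) (f : R -> R) (m : R) :
    Prop :=
  A m /\ forall x, A x -> x != m -> f m < f x.

(* xget returns the element of the (at most singleton) set if there is one;
   the default 0 lies outside of ]0, 1[ and is used only if there is none. *)
Definition Beta_mode {R : realType} (a b : R) : R :=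
  xget 0 [set m | unique_maximizer `]0, 1[ (Beta_pdf a b) m].

Definition Beta_antimode {R : realType} (a b : R) : R :=
  xget 0 [set m | unique_minimizer `]0, 1[ (Beta_pdf a b) m].

(* Main.v *)
Require Import Defs.
From HB Require Import structures.
From mathcomp Require Import all_boot all_order all_algebra.
From mathcomp Require Import all_classical all_reals all_analysis.
From mathcomp Require Import measurable_realfun ring lra.
Import Order.TTheory GRing.Theory Num.Theory.
Import numFieldNormedType.Exports.
Local Open Scope classical_set_scope.
Local Open Scope ring_scope.

(** Let f be the unnormalized density of Beta(a, b), with critical point m.
    P(X > m) is a function of the ratio of the masses of f on ]m, 1[ and
    ]0, m[, so it suffices to compare these two masses, up to a common factor,
    with those of another Beta law with critical point m'. The reflection
    x |-> 1 - x exchanges a and b, so only a has to vary.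

    Modes (a' <= a): compare through the affine map T with T m = m' and slope
    c such that f_(a,b) and f_(a',b) o T have the same logarithmic curvature
    at m. The derivative of ln (f_(a',b) o T) - ln f_(a,b) is then a positive
    factor times (x - m)^2 times an affine function which is nonnegative on
    the common support, so the difference is nondecreasing, which compares the densities in opposite
    directions on the two sides of m.

    Antimodes (a <= a'): use two different maps, the linear ones sending
    [m, 1] onto [m', 1] and [0, m] onto [0, m']. After normalization by the
    value at the critical point the densities compare pointwise on each side
    (because (1 + K / A)^A increases with A on the right, and because
    ln w <= w - 1 on the left), and the slopes of the two maps go in the
    favourable direction. *)

(** * Affine substitution in Lebesgue integrals *)

Lemma measurable_affine {R : realType} (c d : R) :
  measurable_fun [set: measurableTypeR R]
    (fun x : measurableTypeR R => (c * x + d : measurableTypeR R)).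
Proof. by apply: measurable_funD => //; exact: (measurable_funM (f := cst c)). Qed.

(** By uniqueness of Lebesgue measure it is enough to compare both sides on the intervals []a, b]].
    For [c < 0] the preimage is closed at the other end, which leaves its length unchanged. *)
Lemma lebesgue_measure_affine {R : realType} (c d : R) (A : set R) :
  c != 0 -> measurable A ->
  lebesgue_measure A =
  (`|c|%:E * lebesgue_measure ((fun x => c * x + d)%R @^-1` A))%E.
Proof.
move=> c0 mA.
pose T (x : measurableTypeR R) : measurableTypeR R := c * x + d.
have mT : measurable_fun setT T by exact: measurable_affine.
pose mu : {measure set (measurableTypeR R) -> \bar R} :=
  mscale (NngNum (normr_ge0 c)) (pushforward (@lebesgue_measure R) T).
rewrite -[RHS]/(mu mT A).
apply: lebesgue_measure_unique => // _ [[a b]] _ <-.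
rewrite -[RHS]/(`|c|%:E * lebesgue_measure ((fun x => c * x + d)%R @^-1` `]a, b]))%E.
move: c0; rewrite neq_lt => /orP[c0|c0].
  have -> : (fun x => c * x + d) @^-1` `]a, b] = `[(b - d) / c, (a - d) / c[%classic.
    apply/seteqP; split => x /=; rewrite !in_itv/= ler_ndivrMr// ltr_ndivlMr//;
      lra.
  rewrite !lebesgue_measure_itv/= !lte_fin.
  rewrite ltr_ndivrMr// mulfVK ?lt_eqF// ltrD2r.
  case: ifP => _; last by rewrite mule0.
  rewrite -!EFinD -EFinM ltr0_norm//; congr _%:E.
  by field; rewrite lt_eqF.
have -> : (fun x => c * x + d) @^-1` `]a, b] = `](a - d) / c, (b - d) / c]%classic.
  apply/seteqP; split => x /=; rewrite !in_itv/= ltr_pdivrMr// ler_pdivlMr//;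
    lra.
rewrite !lebesgue_measure_itv/= !lte_fin.
rewrite ltr_pdivrMr// mulfVK ?gt_eqF// ltrD2r.
case: ifP => _; last by rewrite mule0.
rewrite -!EFinD -EFinM gtr0_norm//; congr _%:E.
by field; rewrite gt_eqF.
Qed.

Lemma ge0_integral_affine {R : realType} (c d : R) (D : set R)
    (f : R -> \bar R) : c != 0 -> measurable D -> measurable_fun D f ->
  (forall x, D x -> (0 <= f x)%E) ->
  (\int[lebesgue_measure]_(x in D) f x =
   `|c|%:E * \int[lebesgue_measure]_(x in (fun x => c * x + d)%R @^-1` D)
               f (c * x + d)%R)%E.
Proof.
move=> c0 mD mf f0.
pose T (x : measurableTypeR R) : measurableTypeR R := c * x + d.
have mT : measurable_fun setT T by exact: measurable_affine.
pose nu : {measure set (measurableTypeR R) -> \bar R} :=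
  pushforward (@lebesgue_measure R) T.
rewrite (eq_measure_integral (mscale (NngNum (normr_ge0 c)) (nu mT))); last first.
  by move=> A mA _; exact: lebesgue_measure_affine.
rewrite ge0_integral_mscale//=; congr (_ * _)%E.
rewrite ge0_integral_pushforward//=.
by move=> x; rewrite inE; exact: f0.
Qed.

(** * Monotone comparison of two kernels with matched curvature *)

Lemma is_derive_ln_affine {R : realType} (c d x : R) : 0 < c * x + d ->
  is_derive x 1 (fun y => ln (c * y + d)) (c / (c * x + d)).
Proof.
move=> h.
have hd : is_derive x 1 (fun y : R => c * y + d) c.
  by apply: is_derive_eq; rewrite addr0 -[LHS]/(c * 1) mulr1.
have := is_derive1_ln h => hl.
have := @is_derive1_comp R (@ln R) (fun y => c * y + d) x _ _ hl hd.
by rewrite mulrC.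
Qed.

(* [curv] says that the two functions subtracted in [D] have the same second
   derivative at the common critical point [m]. *)
Lemma log_kernel_diff_homo {R : realType} (n n' m m' c : R) :
  0 < n' <= n -> 0 < m < 1 -> 0 < m' < 1 -> 0 < c ->
  n * (m' * (1 - m')) = n' * c ^+ 2 * (m * (1 - m)) ->
  m' <= c * m -> c * (1 - m) <= 1 - m' ->
  let T x := c * x + (m' - c * m) in
  let D x := n' * m' * ln (T x) + n' * (1 - m') * ln (1 - T x)
    - (n * m * ln x + n * (1 - m) * ln (1 - x)) in
  {in `]m - m' / c, 1[ &, {homo D : x y / x <= y}}.
Proof.
move=> /andP[n'0 n'n] /andP[m0 m1] /andP[m'0 m'1] c0 curv m'cm cm T D.
(* [m - m' / c] is the zero of [T]. The two bounds on [c] say that this zero is nonnegative and that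
   [T 1 <= 1], so both logarithmic kernels are defined on the interval. *)
have bnd (x : R) : x \in `]m - m' / c, 1[ ->
    [/\ 0 < x, x < 1, 0 < T x & T x < 1].
  rewrite in_itv/= => /andP[xl xr].
  have cx : c * m - m' < c * x.
    by rewrite -[ltLHS](_ : c * (m - m' / c) = _) ?ltr_pM2l//; field; rewrite gt_eqF.
  have cx1 : c * x < c by rewrite gtr_pMr.
  split=> //; rewrite /T; [|lra|lra].
  by rewrite -(pmulr_rgt0 _ c0); lra.
have Dd (x : R) : x \in `]m - m' / c, 1[ ->
    is_derive x 1 D (n' * m' * (c / T x) + n' * (1 - m') * (- c / (1 - T x))
      - (n * m * (1 / x) + n * (1 - m) * (-1 / (1 - x)))).
  move=> /bnd[x0 x1 T0 T1].
  have d1 : is_derive x 1 (fun y => ln (T y)) (c / T x).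
    exact: is_derive_ln_affine.
  have d2 : is_derive x 1 (fun y => ln (1 - T y)) (- c / (1 - T x)).
    have -> : (fun y => ln (1 - T y)) = (fun y => ln (- c * y + (1 - (m' - c * m)))).
      by apply/funext => y; rewrite /T; congr ln; ring.
    have -> : 1 - T x = - c * x + (1 - (m' - c * m)) by rewrite /T; ring.
    by apply: is_derive_ln_affine; move: T1; rewrite /T; lra.
  have d3 : is_derive x 1 (@ln R) (1 / x) by rewrite div1r; exact: is_derive1_ln.
  have d4 : is_derive x 1 (fun y => ln (1 - y)) (-1 / (1 - x)).
    have -> : (fun y : R => ln (1 - y)) = (fun y => ln (-1 * y + 1)).
      by apply/funext => y; congr ln; ring.
    have -> : 1 - x = -1 * x + 1 by ring.
    by apply: is_derive_ln_affine; lra.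
  pose k (a : R) (f : R -> R) := a *: f.
  rewrite (_ : D = (k (n' * m') (fun y => ln (T y)) +
      k (n' * (1 - m')) (fun y => ln (1 - T y))) -
    (k (n * m) (@ln R) + k (n * (1 - m)) (fun y => ln (1 - y)))); last first.
    by apply/funext.
  rewrite /k.
  by apply: is_deriveB; apply: is_deriveD; apply: is_deriveZ.
apply: ger0_derive1_le_oo.
- by move=> x /Dd h; exact: ex_derive.
- move=> x xI; rewrite derive1E (derive_val (is_derive := Dd x xI)).
  have [x0 x1 T0 T1] := bnd x xI.
  (* By [curv], [n T (1 - T) - n' c^2 z (1 - z)] vanishes at [m]. *)
  pose L z := n * c * (1 - 2 * m') - n' * c ^+ 2 * (1 - 2 * m)
              - (n - n') * c ^+ 2 * (z - m).
  have QL z : n * (T z * (1 - T z)) - n' * c ^+ 2 * (z * (1 - z)) = (z - m) * L z.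
    apply/eqP; rewrite -subr_eq0; apply/eqP.
    transitivity (n * (m' * (1 - m')) - n' * c ^+ 2 * (m * (1 - m))).
      by rewrite /T /L; ring.
    by rewrite curv subrr.
  (* [L] is affine with nonpositive slope, so its sign is decided at [1]. There the subtracted term
     of [QL] vanishes, and [T 1] lies in []0, 1]]. *)
  have L1 : 0 <= L 1.
    have := QL 1; rewrite subrr mulr0 mulr0 subr0 => Q1.
    rewrite -(@pmulr_rge0 _ (1 - m)) ?subr_gt0// -Q1.
    have T11 : T 1 <= 1 by rewrite /T; lra.
    have T10 : 0 < T 1 by rewrite (lt_trans T0)// /T ltrD2r ltr_pM2l.
    by rewrite !mulr_ge0// ?subr_ge0// ltW//; exact: lt_le_trans n'n.
  have Lx : 0 <= L x.
    rewrite (_ : L x = L 1 + (n - n') * c ^+ 2 * (1 - x)); last by rewrite /L; ring.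
    by rewrite addr_ge0// !mulr_ge0// ?subr_ge0// ?sqr_ge0// ltW.
  (* Since [T x - m' = c * (x - m)], both logarithmic derivatives contain the factor [x - m]; [QL]
     supplies the second one. *)
  rewrite (_ : _ + _ = (x - m) ^+ 2 * L x / (T x * (1 - T x) * (x * (1 - x)))).
    apply: divr_ge0; first by rewrite mulr_ge0// sqr_ge0.
    by rewrite ltW// !mulr_gt0// subr_gt0.
  rewrite [(x - m) ^+ 2]expr2 -[(x - m) * _ * L x]mulrA -QL.
  have -> : m' = T x - c * (x - m) by rewrite /T; ring.
  by field; rewrite ?gt_eqF ?subr_gt0.
- move=> x; rewrite inE => xI.
  apply: differentiable_continuous; apply/derivable1_diffP.
  have := Dd x xI => h; exact: ex_derive.
Qed.

(** * Masses of the Beta kernel *)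

Definition Beta_log_kernel {R : realType} (a b x : R) : R :=
  (a - 1) * ln x + (b - 1) * ln (1 - x).

(** Extended-real valued, so that masses can be compared before they are known to be finite. *)
Definition Beta_mass {R : realType} (a b : R) (A : set R) : \bar R :=
  \int[lebesgue_measure]_(x in A) (Beta_kernel a b x)%:E.

Lemma Beta_kernelE {R : realType} (a b x : R) : 0 < x < 1 ->
  Beta_kernel a b x = expR (Beta_log_kernel a b x).
Proof.
move=> /andP[x0 x1]; rewrite /Beta_kernel /powR !gt_eqF ?subr_gt0//.
by rewrite -expRD.
Qed.

Lemma Beta_kernel_ge0 {R : realType} (a b x : R) : 0 <= Beta_kernel a b x.
Proof. by rewrite mulr_ge0// powR_ge0. Qed.

Lemma Beta_kernel_onem {R : realType} (a b x : R) :
  Beta_kernel a b (1 - x) = Beta_kernel b a x.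
Proof. by rewrite /Beta_kernel subKr mulrC. Qed.

Lemma measurable_Beta_kernel {R : realType} (a b : R) (D : set R) :
  measurable_fun D (Beta_kernel a b).
Proof.
apply: measurable_funTS; apply: measurable_funM => //.
apply: (measurableT_comp (measurable_powR _)).
exact: measurable_funB.
Qed.

Lemma measurable_EFin_Beta_kernel {R : realType} (a b : R) (D : set R) :
  measurable_fun D (fun x => (Beta_kernel a b x)%:E).
Proof. by apply/measurable_EFinP; exact: measurable_Beta_kernel. Qed.

Lemma measurable_Beta_kernel_affine {R : realType} (a b c d : R) (D : set R) :
  measurable_fun D (fun x => Beta_kernel a b (c * x + d)).
Proof.
apply: measurable_funTS.
apply: (measurableT_comp (measurable_Beta_kernel a b _)).
by apply: measurable_funD => //; exact: measurable_funM.
Qed.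

Lemma Beta_mass_subset {R : realType} (a b : R) (A B : set R) :
  measurable A -> measurable B -> A `<=` B ->
  (Beta_mass a b A <= Beta_mass a b B)%E.
Proof.
move=> mA mB AB; apply: ge0_subset_integral => //.
  exact: measurable_EFin_Beta_kernel.
by move=> x _; rewrite lee_fin Beta_kernel_ge0.
Qed.

Lemma Beta_mass_sym {R : realType} (a b l r : R) :
  Beta_mass a b `]l, r[ = Beta_mass b a `]1 - r, 1 - l[.
Proof.
rewrite /Beta_mass (@ge0_integral_affine R (-1) 1)//; last 2 first.
- exact: measurable_EFin_Beta_kernel.
- by move=> x _; rewrite lee_fin Beta_kernel_ge0.
rewrite normrN1 mul1e.
have -> : (fun x => -1 * x + 1) @^-1` `]l, r[ = `]1 - r, 1 - l[%classic.
  by apply/seteqP; split => x /=; rewrite !in_itv/=; lra.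
apply: eq_integral => x _; rewrite -[in RHS]Beta_kernel_onem.
by congr (Beta_kernel _ _ _)%:E; ring.
Qed.

(** Exponentiating the pointwise bound gives the factor [expR k], and the change of variables
    contributes [1 / c]. *)
Lemma Beta_mass_affine_le {R : realType} (a b a' b' c d k l r : R) : 0 < c ->
  (forall x, l < x < r -> [/\ 0 < x < 1, 0 < c * x + d < 1 &
    Beta_log_kernel a b x <= k + Beta_log_kernel a' b' (c * x + d)]) ->
  (Beta_mass a b `]l, r[ <=
     (expR k / c)%:E * Beta_mass a' b' `](c * l + d)%R, (c * r + d)%R[)%E.
Proof.
move=> c0 H; rewrite {2}/Beta_mass (@ge0_integral_affine R c d)//; last 3 first.
- by rewrite gt_eqF.
- exact: measurable_EFin_Beta_kernel.
- by move=> x _; rewrite lee_fin Beta_kernel_ge0.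
have -> : (fun x => c * x + d) @^-1` `](c * l + d), (c * r + d)[ = `]l, r[%classic.
  by apply/seteqP; split => x /=; rewrite !in_itv/= !ltrD2r !ltr_pM2l.
rewrite muleA -EFinM gtr0_norm// divfK ?gt_eqF// -ge0_integralZl//; last 2 first.
- apply/measurable_EFinP; exact: measurable_Beta_kernel_affine.
- by move=> x _; rewrite lee_fin Beta_kernel_ge0.
apply: ge0_le_integral => //.
- by move=> x _; rewrite lee_fin Beta_kernel_ge0.
- exact: measurable_EFin_Beta_kernel.
- apply: measurable_funeM; apply/measurable_EFinP.
  exact: measurable_Beta_kernel_affine.
move=> x /=; rewrite in_itv/= => /H[x01 T01 le].
by rewrite -EFinM lee_fin !Beta_kernelE// -expRD ler_expR.
Qed.

(** * Tail probabilities of a Beta law as ratios of masses *)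

Lemma Beta_law_massE {R : realType} {d : measure_display}
    {T : measurableType d} {P : probability T R} {X : {RV P >-> R}} {a b : R}
    {V : set R} : has_Beta_law X a b -> measurable V ->
  distribution P X V =
  ((Beta_fun a b)^-1%:E * Beta_mass a b (V `&` `]0%R, 1%R[))%E.
Proof.
move=> XB mV; rewrite XB//.
rewrite /Beta_pdf -[X in integral _ _ X]/(EFin \o _) -restrict_EFin.
rewrite -integral_mkcondr.
under eq_integral do rewrite /= mulrC EFinM.
rewrite ge0_integralZl//.
- exact: measurableI.
- exact: measurable_EFin_Beta_kernel.
- by move=> x _; rewrite lee_fin Beta_kernel_ge0.
- by rewrite lee_fin invr_ge0 Rintegral_ge0// => x _; exact: Beta_kernel_ge0.
Qed.

(** Both facts come from the total probability 1: if [Beta_fun] were 0, so would be its inverse and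
    the total probability, and an infinite mass would make that probability infinite. *)
Lemma Beta_law_Beta_fun {R : realType} {d : measure_display}
    {T : measurableType d} {P : probability T R} {X : {RV P >-> R}} {a b : R} :
  has_Beta_law X a b ->
  0 < Beta_fun a b /\ Beta_mass a b `]0, 1[ = (Beta_fun a b)%:E.
Proof.
move=> XB; have B0 : 0 <= Beta_fun a b.
  by rewrite Rintegral_ge0// => x _; exact: Beta_kernel_ge0.
have := Beta_law_massE XB measurableT.
rewrite setTI probability_setT.
have : (0 <= Beta_mass a b `]0%R, 1%R[)%E.
  by apply: integral_ge0 => x _; rewrite lee_fin Beta_kernel_ge0.
have [<-|Bn0] := eqVneq 0 (Beta_fun a b).
  by move=> _ /eqP; rewrite invr0 mul0e onee_eq0.
have {}B0 : 0 < Beta_fun a b by rewrite lt_def eq_sym Bn0.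
case: (Beta_mass _ _ _) => [s| |]//= _.
  move=> [] E; split=> //; congr _%:E.
  by rewrite -[s](mulVKf (lt0r_neq0 B0)) -E mulr1.
by rewrite gt0_muley// lte_fin invr_gt0.
Qed.

Lemma Beta_law_tail {R : realType} {d : measure_display}
    {T : measurableType d} {P : probability T R} {X : {RV P >-> R}}
    {a b m : R} : has_Beta_law X a b -> 0 < m < 1 ->
  exists u v : R, [/\ 0 <= u, 0 <= v & 0 < u + v] /\
    [/\ Beta_mass a b `]m, 1[ = u%:E, Beta_mass a b `]0, m[ = v%:E &
        P [set w | m < X w] = (u / (u + v))%:E].
Proof.
move=> XB /andP[m0 m1]; have [B0 BE] := Beta_law_Beta_fun XB.
have split01 : Beta_mass a b `]0, 1[ =
      (Beta_mass a b `]0%R, m[ + Beta_mass a b `]m, 1%R[)%E.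
  (* Adding the null point [m] to the left interval makes the two pieces a partition of []0, 1[]. *)
  rewrite /Beta_mass [X in _ = (X + _)%E]integral_itv_bndo_bndc;
    last exact: measurable_EFin_Beta_kernel.
  rewrite -ge0_integral_setU//.
  - congr integral; apply/seteqP; split=> x /=; rewrite !in_itv/=.
      by case: (leP x m) => ? /andP[-> ?]; [left|right].
    by move=> [|] /andP[? ?]; apply/andP; split=> //; lra.
  - exact: measurable_EFin_Beta_kernel.
  - by move=> x _; rewrite lee_fin Beta_kernel_ge0.
  - apply/disj_setPS => x /=; rewrite !in_itv/= => -[/andP[_ xm] /andP[mx _]].
    by rewrite ltNge xm in mx.
have mass_ge0 A : (0 <= Beta_mass a b A)%E.
  by apply: integral_ge0 => x _; rewrite lee_fin Beta_kernel_ge0.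
have tail : P [set w | m < X w] =
    ((Beta_fun a b)^-1%:E * Beta_mass a b `]m, 1%R[)%E.
  have -> : `]m, 1[%classic = `]m, +oo[ `&` `]0, 1[ :> set R.
    apply/seteqP; split=> x /=; rewrite !in_itv/= ?andbT.
      by move=> /andP[mx ->]; rewrite mx (lt_trans m0).
    by move=> [-> /andP[_ ->]].
  rewrite -(Beta_law_massE XB)// /distribution /pushforward.
  by congr (P _); apply/seteqP; split=> w /=; rewrite in_itv/= andbT.
move: split01 tail (mass_ge0 `]0, m[%classic) (mass_ge0 `]m, 1[%classic).
rewrite BE.
case: (Beta_mass _ _ `]0, m[) => [v| |]//;
  case: (Beta_mass _ _ `]m, 1[) => [u| |]//.
rewrite !lee_fin => -[] E tail v0 u0.
exists u, v; split; first by rewrite addrC -E.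
by split=> //; rewrite tail addrC -E -EFinM mulrC.
Qed.

(** Cross-multiplied, the claim is [u * v' <= u' * v]. Both sides are compared with
    [k * u' * v']. *)
Lemma ler_div_add {R : realFieldType} {k u v u' v' : R} :
  0 < k -> 0 <= u -> 0 <= v' -> 0 < u + v -> 0 < u' + v' ->
  u <= k * u' -> v' <= k^-1 * v -> u / (u + v) <= u' / (u' + v').
Proof.
move=> k0 u0 v'0 uv u'v' ule v'le.
rewrite ler_pdivrMr// mulrAC ler_pdivlMr//.
have kv : k * v' <= v by rewrite -ler_pdivlMl.
have u'0 : 0 <= u' by rewrite -(pmulr_rge0 _ k0) (le_trans u0).
rewrite !mulrDr [u' * u]mulrC lerD2l.
apply: (@le_trans _ _ (k * u' * v')); first by rewrite ler_wpM2r.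
by rewrite -mulrA mulrCA ler_wpM2l.
Qed.

(** * Modes and antimodes *)

(** This is [1 + t < expR t] at the nonzero point [t = ln (x / m)], scaled by [m]. *)
Lemma mulr_lnB_lt {R : realType} {m x : R} : 0 < m -> 0 < x -> x != m ->
  m * (ln x - ln m) < x - m.
Proof.
move=> m0 x0 xm; rewrite -ln_div ?posrE//.
have xm0 : 0 < x / m by rewrite divr_gt0.
have : ln (x / m) != 0.
  rewrite ln_eq0// -subr_eq0 -(divff (lt0r_neq0 m0)) -mulrBl.
  by rewrite mulf_neq0// ?subr_eq0// invr_eq0 gt_eqF.
move=> /expR_gt1Dx; rewrite lnK ?posrE// -ltrBrDl => h.
rewrite -(ltr_pM2l m0) in h.
by rewrite (lt_le_trans h)// mulrBr mulr1 mulrCA divff ?gt_eqF// mulr1.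
Qed.

Definition Beta_crit {R : realType} (a b : R) : R := (a - 1) / (a + b - 2).

Lemma onem_Beta_crit {R : realType} (a b : R) : a + b - 2 != 0 ->
  1 - Beta_crit a b = Beta_crit b a.
Proof. by move=> n0; rewrite /Beta_crit [b + a]addrC; field. Qed.

Lemma Beta_crit_gt1 {R : realType} {a b : R} : 1 < a -> 1 < b ->
  0 < Beta_crit a b < 1.
Proof.
move=> a1 b1; have n0 : 0 < a + b - 2 by lra.
by rewrite /Beta_crit divr_gt0 ?ltr_pdivrMr//; lra.
Qed.

Lemma Beta_crit_lt1 {R : realType} {a b : R} : a < 1 -> b < 1 ->
  0 < Beta_crit a b < 1.
Proof.
move=> a1 b1; have n0 : 0 < 2 - a - b by lra.
rewrite /Beta_crit -mulrNN -invrN.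
have -> : - (a + b - 2) = 2 - a - b by ring.
by rewrite divr_gt0 ?ltr_pdivrMr//; lra.
Qed.

(** Isolates the factor [a + b - 2], whose sign decides between mode and antimode. *)
Lemma Beta_log_kernelE {R : realType} (a b x : R) : a + b - 2 != 0 ->
  let m := Beta_crit a b in
  Beta_log_kernel a b x = (a + b - 2) * (m * ln x + (1 - m) * ln (1 - x)).
Proof. by move=> n0 m; rewrite /Beta_log_kernel /m /Beta_crit; field. Qed.

(** Gibbs' inequality for two-point distributions: the tangent bounds for [x] at [m] and for [1 - x]
    at [1 - m] have right-hand sides that sum to 0. *)
Lemma log_kernel_lt {R : realType} {m x : R} : 0 < m < 1 -> 0 < x < 1 ->
  x != m ->
  m * ln x + (1 - m) * ln (1 - x) < m * ln m + (1 - m) * ln (1 - m).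
Proof.
move=> /andP[m0 m1] /andP[x0 x1] xm.
have h1 := mulr_lnB_lt m0 x0 xm.
have h2 : (1 - m) * (ln (1 - x) - ln (1 - m)) < (1 - x) - (1 - m).
  apply: mulr_lnB_lt; rewrite ?subr_gt0//.
  by apply: contra_neq xm => h; lra.
lra.
Qed.

Lemma Beta_pdfE {R : realType} (a b x : R) : 0 < x < 1 ->
  Beta_pdf a b x = expR (Beta_log_kernel a b x) / Beta_fun a b.
Proof.
move=> x01; rewrite /Beta_pdf patchE mem_set ?Beta_kernelE//=.
Qed.

Lemma Beta_modeE {R : realType} (a b : R) : 1 < a -> 1 < b ->
  0 < Beta_fun a b -> Beta_mode a b = Beta_crit a b.
Proof.
move=> a1 b1 B0; have m01 := Beta_crit_gt1 a1 b1.
have max : unique_maximizer `]0, 1[ (Beta_pdf a b) (Beta_crit a b).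
  split=> [|x]; first by rewrite /= in_itv.
  rewrite /= in_itv/= => x01 xm.
  rewrite !Beta_pdfE// ltr_pM2r ?invr_gt0// ltr_expR.
  have n0 : 0 < a + b - 2 by lra.
  by rewrite !Beta_log_kernelE ?gt_eqF// ltr_pM2l// log_kernel_lt.
apply: xget_unique => // y [y01 ymax]; apply/eqP/negP => /negP ym.
have := max.2 y y01 ym; rewrite ltNge => /negP; apply.
by apply/ltW/ymax; [exact: max.1|rewrite eq_sym].
Qed.

Lemma Beta_antimodeE {R : realType} (a b : R) : a < 1 -> b < 1 ->
  0 < Beta_fun a b -> Beta_antimode a b = Beta_crit a b.
Proof.
move=> a1 b1 B0; have m01 := Beta_crit_lt1 a1 b1.
have min : unique_minimizer `]0, 1[ (Beta_pdf a b) (Beta_crit a b).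
  split=> [|x]; first by rewrite /= in_itv.
  rewrite /= in_itv/= => x01 xm.
  rewrite !Beta_pdfE// ltr_pM2r ?invr_gt0// ltr_expR.
  have n0 : a + b - 2 < 0 by lra.
  by rewrite !Beta_log_kernelE ?lt_eqF// ltr_nM2l// log_kernel_lt.
apply: xget_unique => // y [y01 ymin]; apply/eqP/negP => /negP ym.
have := min.2 y y01 ym; rewrite ltNge => /negP; apply.
by apply/ltW/ymin; [exact: min.1|rewrite eq_sym].
Qed.

(* By [ler_div_add], this makes the relative mass above [m] under parameters
   [a, b] at most the one above [m'] under [a', b']. *)
Definition Beta_shift {R : realType} (a b m a' b' m' : R) : Prop :=
  exists2 k : R, 0 < k &
    (Beta_mass a b `]m, 1%R[ <= k%:E * Beta_mass a' b' `]m', 1%R[)%E /\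
    (Beta_mass a' b' `]0%R, m'[ <= k^-1%:E * Beta_mass a b `]0%R, m[)%E.

(** Reflection exchanges the two mass inequalities and inverts [k]. This transfers results on the
    first parameter to the second. *)
Lemma Beta_shift_onem {R : realType} {a b m a' b' m' : R} :
  Beta_shift a b m a' b' m' -> Beta_shift b' a' (1 - m') b a (1 - m).
Proof.
move=> [k k0 [h1 h2]]; exists k^-1; first by rewrite invr_gt0.
by rewrite ![Beta_mass b _ _]Beta_mass_sym ![Beta_mass b' _ _]Beta_mass_sym
  subrr !subr0 !subKr invrK.
Qed.

Lemma Beta_shift_tail_le {R : realType} {d d' : measure_display}
    {T : measurableType d} {P : probability T R} {X : {RV P >-> R}}
    {T' : measurableType d'} {P' : probability T' R} {X' : {RV P' >-> R}}
    {a b m a' b' m' : R} :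
  has_Beta_law X a b -> has_Beta_law X' a' b' -> 0 < m < 1 -> 0 < m' < 1 ->
  Beta_shift a b m a' b' m' ->
  (P [set w | (m < X w)%R] <= P' [set w | (m' < X' w)%R])%E.
Proof.
move=> XB XB' m01 m01' [k k0].
have [u [v [[u0 v0 uv] [-> -> ->]]]] := Beta_law_tail XB m01.
have [u' [v' [[u'0 v'0 uv'] [-> -> ->]]]] := Beta_law_tail XB' m01'.
by rewrite -!EFinM !lee_fin => -[h1 h2]; exact: ler_div_add h1 h2.
Qed.

(** * Comparison at the modes *)

(** To be used with [p = a - 1], [p' = a' - 1], [q = b - 1]. Squaring removes the root from the two
    bounds on [c], which then follow from [p' <= p]. *)
Lemma curvature_slope {R : realType} (p p' q : R) : 0 < p' <= p -> 0 < q ->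
  let m := p / (p + q) in let m' := p' / (p' + q) in
  exists c : R, [/\ 0 < c,
    (p + q) * (m' * (1 - m')) = (p' + q) * c ^+ 2 * (m * (1 - m)),
    m' <= c * m & c * (1 - m) <= 1 - m'].
Proof.
move=> /andP[p'0 p'p] q0 m m'.
have p0 : 0 < p by exact: lt_le_trans p'p.
have n0 : 0 < p + q by rewrite addr_gt0.
have n'0 : 0 < p' + q by rewrite addr_gt0.
(* [s] is the solution of the curvature equation for [c ^+ 2]. *)
pose s := (p + q) ^+ 3 * p' / ((p' + q) ^+ 3 * p).
have s0 : 0 < s by rewrite divr_gt0// mulr_gt0// exprn_gt0.
pose c : R := Num.sqrt s.
have c0 : 0 < c by rewrite sqrtr_gt0.
have c2 : c ^+ 2 = s by rewrite sqr_sqrtr// ltW.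
exists c; split=> //.
- by rewrite c2 /s /m /m'; field; rewrite !gt_eqF.
- rewrite -ler_sqr ?nnegrE; [|by rewrite ltW// divr_gt0|
    by rewrite ltW// !mulr_gt0// invr_gt0].
  rewrite [(c * _) ^+ 2]exprMn c2 -subr_ge0.
  rewrite (_ : _ - _ = p' * ((p + q) * p - p' * (p' + q)) / (p' + q) ^+ 3); last first.
    by rewrite /s /m /m'; field; rewrite !gt_eqF.
  apply: divr_ge0; last by rewrite ltW// exprn_gt0.
  apply: mulr_ge0; first exact: ltW.
  by rewrite subr_ge0 mulrC; apply: ler_pM; rewrite ?lerD2r// ltW.
- have -> : 1 - m = q / (p + q) by rewrite /m; field; rewrite gt_eqF.
  have -> : 1 - m' = q / (p' + q) by rewrite /m'; field; rewrite gt_eqF.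
  rewrite -ler_sqr ?nnegrE; [|by rewrite ltW// !mulr_gt0// invr_gt0|
    by rewrite ltW// divr_gt0].
  rewrite [(c * _) ^+ 2]exprMn c2 -subr_ge0.
  rewrite (_ : _ - _ = q ^+ 3 * (p - p') / ((p' + q) ^+ 3 * p)); last first.
    by rewrite /s; field; rewrite !gt_eqF.
  apply: divr_ge0; first by rewrite mulr_ge0 ?subr_ge0// exprn_ge0// ltW.
  by rewrite ltW// mulr_gt0// exprn_gt0.
Qed.

Lemma Beta_shift_mode {R : realType} {a a' b : R} :
  1 < a' -> a' <= a -> 1 < b ->
  Beta_shift a b (Beta_crit a b) a' b (Beta_crit a' b).
Proof.
move=> a'1 a'a b1; have a1 : 1 < a by exact: lt_le_trans a'a.
set m := Beta_crit a b; set m' := Beta_crit a' b.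
have /andP[m0 m1] : 0 < m < 1 by exact: Beta_crit_gt1.
have /andP[m'0 m'1] : 0 < m' < 1 by exact: Beta_crit_gt1.
have n0 : 0 < a + b - 2 by lra.
have n'0 : 0 < a' + b - 2 by lra.
have [c [c0 curv m'cm cm]] : exists c : R, [/\ 0 < c,
    (a + b - 2) * (m' * (1 - m')) = (a' + b - 2) * c ^+ 2 * (m * (1 - m)),
    m' <= c * m & c * (1 - m) <= 1 - m'].
  have := @curvature_slope R (a - 1) (a' - 1) (b - 1).
  have -> : a - 1 + (b - 1) = a + b - 2 by ring.
  have -> : a' - 1 + (b - 1) = a' + b - 2 by ring.
  by apply; lra.
have := @log_kernel_diff_homo R (a + b - 2) (a' + b - 2) m m' c.
rewrite n'0 m0 m1 m'0 m'1 => /(_ _ isT isT c0 curv m'cm cm).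
have -> : a' + b - 2 <= a + b - 2 by lra.
move=> /(_ isT) /= Dhomo0.
have m'c0 : 0 < m' / c by rewrite divr_gt0.
have m'cm' : m' / c <= m by rewrite ler_pdivrMr// mulrC.
have mI : m \in `]m - m' / c, 1[ by rewrite in_itv/=; lra.
(* The inner expression is the inverse of the affine map. *)
have cV x : c * (c^-1 * x + (m - m' / c)) + (m' - c * m) = x.
  by field; rewrite gt_eqF.
have lkE z : Beta_log_kernel a b z =
    (a + b - 2) * m * ln z + (a + b - 2) * (1 - m) * ln (1 - z).
  by rewrite /Beta_log_kernel /m /Beta_crit; field; rewrite gt_eqF.
have lkE' z : Beta_log_kernel a' b z =
    (a' + b - 2) * m' * ln z + (a' + b - 2) * (1 - m') * ln (1 - z).
  by rewrite /Beta_log_kernel /m' /Beta_crit; field; rewrite gt_eqF.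
have Dhomo x y : x \in `]m - m' / c, 1[ -> y \in `]m - m' / c, 1[ -> x <= y ->
    Beta_log_kernel a' b (c * x + (m' - c * m)) - Beta_log_kernel a b x <=
    Beta_log_kernel a' b (c * y + (m' - c * m)) - Beta_log_kernel a b y.
  move=> xI yI xy; have := Dhomo0 x y xI yI xy.
  by rewrite !lkE !lkE'.
have xI x : m < x < 1 -> x \in `]m - m' / c, 1[ by rewrite in_itv/=; lra.
(* [- kap] is the value at [m] of the monotone difference in [Dhomo]; the slope of the affine map
   accounts for the division by [c] in the witness. *)
pose kap := Beta_log_kernel a b m - Beta_log_kernel a' b m'.
have Tm : c * m + (m' - c * m) = m' by ring.
exists (expR kap / c); first by rewrite divr_gt0// expR_gt0.
split.
- have H : forall x, m < x < 1 -> [/\ 0 < x < 1, 0 < c * x + (m' - c * m) < 1 &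
      Beta_log_kernel a b x <= kap + Beta_log_kernel a' b (c * x + (m' - c * m))].
    move=> x mx; have := Dhomo _ _ mI (xI x mx); rewrite Tm.
    move: mx => /andP[mx x1] /(_ (ltW mx)) h.
    have cmx : c * m < c * x by rewrite ltr_pM2l.
    have cx1 : c * x < c by rewrite gtr_pMr.
    by split; [lra|lra|rewrite /kap; lra].
  apply: (le_trans (Beta_mass_affine_le a b a' b c _ _ _ _ c0 H)).
  rewrite lee_pmul2l ?lte_fin ?divr_gt0 ?expR_gt0//.
  (* The image of []m, 1[] starts at [m'] and stops at or before 1, so enlarging it to []m', 1[]
     keeps the bound. *)
  apply: Beta_mass_subset => //= x /=; rewrite !in_itv/= Tm => /andP[-> h].
  by rewrite (lt_le_trans h)//; lra.
(* The inverse map sends []0, m'[] onto []m - m' / c, m[], which lies in []0, m[]; its slope [c^-1]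
   produces exactly the inverse of the first constant. *)
- have ci0 : 0 < c^-1 by rewrite invr_gt0.
  have H : forall x, 0 < x < m' -> [/\ 0 < x < 1, 0 < c^-1 * x + (m - m' / c) < 1 &
      Beta_log_kernel a' b x <= - kap + Beta_log_kernel a b (c^-1 * x + (m - m' / c))].
    move=> x /andP[x0 xm'].
    have cx0 : 0 < c^-1 * x by rewrite mulr_gt0.
    have cxm : c^-1 * x < m' / c by rewrite mulrC ltr_pM2r.
    have yI : c^-1 * x + (m - m' / c) \in `]m - m' / c, 1[ by rewrite in_itv/=; lra.
    have := Dhomo _ _ yI mI; rewrite cV Tm => h.
    by split; [lra|lra|rewrite /kap; move: h; lra].
  apply: (le_trans (Beta_mass_affine_le a' b a b c^-1 _ _ _ _ ci0 H)).
  rewrite invf_div expRN invrK [(expR kap)^-1 * c]mulrC.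
  rewrite lee_pmul2l ?lte_fin ?divr_gt0 ?expR_gt0//.
  apply: Beta_mass_subset => //= x /=; rewrite !in_itv/= mulr0 add0r.
  by rewrite [c^-1 * m']mulrC [m' / c + _]addrC subrK => /andP[h ->]; lra.
Qed.

(** * Comparison at the antimodes *)

Lemma mulr_lnB_le {R : realType} {m x : R} : 0 < m -> 0 < x ->
  m * (ln x - ln m) <= x - m.
Proof.
move=> m0 x0; have [->|xm] := eqVneq x m; first by rewrite !subrr mulr0.
exact/ltW/mulr_lnB_lt.
Qed.

(** Concavity of [ln]: [1 + K / A] is the average of [1 + K / A'] and [1] with weights [A' / A] and
    [1 - A' / A]. The proof combines the tangent bounds at this average. *)
Lemma mulr_ln1D_div_homo {R : realType} (K A' A : R) : 0 <= K -> 0 < A' <= A ->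
  A' * ln (1 + K / A') <= A * ln (1 + K / A).
Proof.
move=> K0 /andP[A'0 A'A]; have A0 : 0 < A by exact: lt_le_trans A'A.
set y := 1 + K / A; set z := 1 + K / A'.
have y0 : 0 < y by rewrite ltr_wpDr// divr_ge0// ltW.
have z0 : 0 < z by rewrite ltr_wpDr// divr_ge0// ltW.
have h1 := mulr_lnB_le y0 z0.
have := mulr_lnB_le y0 ltr01; rewrite ln1 => h2.
rewrite -(ler_pM2l y0).
have zyE : A' * (z - y) = (A - A') * (y - 1).
  by rewrite /z /y; field; rewrite !gt_eqF.
have h3 : A' * (y * (ln z - ln y)) <= (A - A') * (y - 1).
  by rewrite -zyE ler_pM2l.
have h4 : (A - A') * (y - 1) <= (A - A') * (y * ln y).
  by rewrite ler_wpM2l ?subr_ge0//; lra.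
have -> : y * (A' * ln z) = A' * (y * (ln z - ln y)) + A' * (y * ln y) by ring.
by rewrite [leRHS]mulrCA -lerBrDr -mulrBl; exact: le_trans h3 h4.
Qed.

(** Passing from [A'] to [A] lowers the first term by at least [(A - A') * (1 - w)] and raises the
    second by at most that much, because [ln] is 1-Lipschitz above 1. *)
Lemma ln_le_compensate {R : realType} (A A' B w : R) :
  0 < A' <= A -> 0 < B -> 0 < w <= 1 ->
  A * ln w + B * ln (1 + A / B * (1 - w)) <=
  A' * ln w + B * ln (1 + A' / B * (1 - w)).
Proof.
move=> /andP[A'0 A'A] B0 /andP[w0 w1].
set y := 1 + A / B * _; set y' := 1 + A' / B * _.
have y'1 : 1 <= y' by rewrite lerDl mulr_ge0 ?divr_ge0 ?subr_ge0// ltW.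
have yy' : y' <= y by rewrite lerD2l ler_wpM2r ?subr_ge0// ler_pM2r// invr_gt0.
have y'0 : 0 < y' by lra.
have y0 : 0 < y by lra.
have h1 := mulr_lnB_le y'0 y0.
have h2 : ln y - ln y' <= y - y'.
  by apply: le_trans h1; rewrite ler_peMl// subr_ge0 ler_ln.
have := mulr_lnB_le ltr01 w0; rewrite ln1 mul1r subr0 => h3.
have h4 : B * (ln y - ln y') <= (A - A') * (1 - w).
  rewrite (_ : (A - A') * _ = B * (y - y')) ?ler_pM2l//.
  by rewrite /y /y'; field; rewrite gt_eqF.
have h5 : (A - A') * ln w <= (A - A') * (w - 1) by rewrite ler_wpM2l// subr_ge0.
lra.
Qed.

Lemma Beta_shift_antimode {R : realType} {a a' b : R} :
  a <= a' -> a' < 1 -> b < 1 ->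
  Beta_shift a b (Beta_crit a b) a' b (Beta_crit a' b).
Proof.
move=> aa' a'1 b1; have a1 : a < 1 by exact: le_lt_trans aa' _.
set m := Beta_crit a b; set m' := Beta_crit a' b.
have /andP[m0 m1] : 0 < m < 1 by exact: Beta_crit_lt1.
have /andP[m'0 m'1] : 0 < m' < 1 by exact: Beta_crit_lt1.
pose A : R := 1 - a; pose A' : R := 1 - a'; pose B : R := 1 - b.
have A'0 : 0 < A' by rewrite subr_gt0.
have A0 : 0 < A by rewrite subr_gt0.
have B0 : 0 < B by rewrite subr_gt0.
have A'A : A' <= A by rewrite /A /A'; lra.
have mE : m = A / (A + B).
  rewrite /m /Beta_crit (_ : a - 1 = - A); last by rewrite /A; ring.
  rewrite (_ : a + b - 2 = - (A + B)); last by rewrite /A /B; ring.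
  by rewrite invrN mulrNN.
have m'E : m' = A' / (A' + B).
  rewrite /m' /Beta_crit (_ : a' - 1 = - A'); last by rewrite /A'; ring.
  rewrite (_ : a' + b - 2 = - (A' + B)); last by rewrite /A' /B; ring.
  by rewrite invrN mulrNN.
have lkE z : Beta_log_kernel a b z = - (A * ln z + B * ln (1 - z)).
  by rewrite /Beta_log_kernel /A /B; ring.
have lkE' z : Beta_log_kernel a' b z = - (A' * ln z + B * ln (1 - z)).
  by rewrite /Beta_log_kernel /A' /B; ring.
clearbody m m' A A' B.
have AB0 : 0 < A + B by rewrite addr_gt0.
have A'B0 : 0 < A' + B by rewrite addr_gt0.
have m'm : m' <= m.
  rewrite mE m'E ler_pdivrMr// mulrAC ler_pdivlMr// !mulrDr mulrC lerD2l.
  by rewrite ler_pM2r.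
have lnE (z s t : R) : 0 < t -> 0 < s -> s = z * t -> 0 < z -> ln s - ln t = ln z.
  by move=> t0 s0 -> z0; rewrite lnM ?posrE// addrK.
pose kap := Beta_log_kernel a b m - Beta_log_kernel a' b m'.
exists (expR kap); first exact: expR_gt0.
have mass_ge0 (u v : R) (D : set R) : (0 <= Beta_mass u v D)%E.
  by apply: integral_ge0 => x _; rewrite lee_fin Beta_kernel_ge0.
split.
- pose c : R := (1 - m') / (1 - m).
  have c0 : 0 < c by rewrite divr_gt0// subr_gt0.
  have c1 : 1 <= c by rewrite ler_pdivlMr ?subr_gt0//; lra.
  have Tm : c * m + (1 - c) = m'.
    by rewrite /c; field; rewrite gt_eqF// subr_gt0.
  have H : forall x, m < x < 1 -> [/\ 0 < x < 1, 0 < c * x + (1 - c) < 1 &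
      Beta_log_kernel a b x <= kap + Beta_log_kernel a' b (c * x + (1 - c))].
    move=> x /andP[mx x1].
    have x0 : 0 < x by exact: lt_trans mx.
    have cmx : c * m < c * x by rewrite ltr_pM2l.
    have cx1 : c * x < c by rewrite gtr_pMr.
    split; [lra|lra|].
    (* The map preserves the ratio [(1 - x) / (1 - m)], so after normalization only the [A] and [A']
       terms differ. One [K] describes both: [x / m = 1 + K / A], and the image of [x] divided by
       [m'] is [1 + K / A']. *)
    pose K : R := B * (1 - (1 - x) / (1 - m)).
    have K0 : 0 <= K.
      rewrite mulr_ge0 ?subr_ge0 ?ler_pdivrMr ?subr_gt0//; lra.
    have := @mulr_ln1D_div_homo R K A' A K0; rewrite A'0 A'A => /(_ isT).
    have xE : x = (1 + K / A) * m.
      rewrite /K mE; field; rewrite !gt_eqF//.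
      by rewrite (_ : A + B - A = B)//; ring.
    have TxE : c * x + (1 - c) = (1 + K / A') * m'.
      rewrite /K /c mE m'E; field; rewrite !gt_eqF//.
      by rewrite (_ : A + B - A = B)//; ring.
    have z0 : 0 < 1 + K / A by rewrite ltr_wpDr// divr_ge0// ltW.
    have z'0 : 0 < 1 + K / A' by rewrite ltr_wpDr// divr_ge0// ltW.
    have Tx0 : 0 < c * x + (1 - c) by lra.
    rewrite -(lnE _ _ _ m0 x0 xE z0) -(lnE _ _ _ m'0 Tx0 TxE z'0).
    have := @lnE c (1 - (c * x + (1 - c))) (1 - x).
    have := @lnE c (1 - m') (1 - m).
    rewrite !subr_gt0 => /(_ m1 m'1 _ c0) e1 /(_ x1 _ _ c0) e2.
    have {}e1 : ln (1 - m') - ln (1 - m) = ln c.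
      by apply: e1; rewrite /c divfK// gt_eqF// subr_gt0.
    have {}e2 : ln (1 - (c * x + (1 - c))) - ln (1 - x) = ln c.
      by apply: e2; [lra|ring].
    have e : ln (1 - (c * x + (1 - c))) = ln (1 - m') - ln (1 - m) + ln (1 - x).
      by lra.
    rewrite /kap !lkE !lkE' e; lra.
  apply: (le_trans (Beta_mass_affine_le a b a' b c _ _ _ _ c0 H)).
  rewrite Tm mulr1 [c + _]addrC subrK lee_wpmul2r// lee_fin.
  by rewrite ler_pdivrMr// ler_peMr// expR_ge0.
(* Slope of the linear map from []0, m'[] onto []0, m[], again at least 1. *)
- pose c : R := m / m'.
  have c0 : 0 < c by rewrite divr_gt0.
  have c1 : 1 <= c by rewrite ler_pdivlMr// mul1r.
  have H : forall x, 0 < x < m' -> [/\ 0 < x < 1, 0 < c * x + 0 < 1 &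
      Beta_log_kernel a' b x <= - kap + Beta_log_kernel a b (c * x + 0)].
    move=> y /andP[y0 ym']; rewrite addr0.
    have cy0 : 0 < c * y by rewrite mulr_gt0.
    have cym : c * y < m.
      by rewrite -[ltRHS](_ : c * m' = m) ?ltr_pM2l// /c divfK// gt_eqF.
    split; [lra|lra|].
    (* [w] is also [c * y / m], so the first logarithms agree after normalization; the ratios of the
       complements are [1 + A / B * (1 - w)] and [1 + A' / B * (1 - w)]. *)
    pose w : R := y / m'.
    have w0 : 0 < w by rewrite divr_gt0.
    have w1 : w <= 1 by rewrite ler_pdivrMr// mul1r ltW.
    have := @ln_le_compensate R A A' B w.
    rewrite A'0 A'A B0 w0 w1 => /(_ isT isT isT).
    have y1 : 0 < 1 + A / B * (1 - w).
      by rewrite ltr_wpDr// mulr_ge0 ?subr_ge0// divr_ge0// ltW.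
    have y'1 : 0 < 1 + A' / B * (1 - w).
      by rewrite ltr_wpDr// mulr_ge0 ?subr_ge0// divr_ge0// ltW.
    have e1 : ln y - ln m' = ln w by apply: lnE => //; rewrite /w divfK// gt_eqF.
    have e2 : ln (c * y) - ln m = ln w.
      by apply: lnE => //; rewrite /w /c; field; rewrite gt_eqF.
    have e3 : ln (1 - c * y) - ln (1 - m) = ln (1 + A / B * (1 - w)).
      apply: lnE => //; rewrite ?subr_gt0//; first lra.
      by rewrite /w /c mE m'E; field; rewrite !gt_eqF.
    have e4 : ln (1 - y) - ln (1 - m') = ln (1 + A' / B * (1 - w)).
      apply: lnE => //; rewrite ?subr_gt0//; first lra.
      by rewrite /w m'E; field; rewrite !gt_eqF.
    rewrite -e3 -e4 /kap !lkE !lkE' -{1}e2 -e1; lra.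
  apply: (le_trans (Beta_mass_affine_le a' b a b c _ _ _ _ c0 H)).
  rewrite mulr0 !addr0 /c divfK ?gt_eqF// -/c expRN lee_wpmul2r// lee_fin.
  by rewrite ler_pdivrMr// ler_peMr// invr_ge0 expR_ge0.
Qed.

(** * Monotonicity of the tail probabilities *)

Theorem corollary10 (R : realType)
    (d : R -> R -> measure_display)
    (T : forall a b : R, measurableType (d a b))
    (P : forall a b : R, probability (T a b) R)
    (X : forall a b : R, {RV (P a b) >-> R})
    (hX : forall a b : R, 0 < a -> 0 < b -> has_Beta_law (X a b) a b) :
  let p (a b : R) : \bar R := P a b [set w | Beta_mode a b < X a b w] in
  let q (a b : R) : \bar R := P a b [set w | Beta_antimode a b < X a b w] in
  ((forall a a' b : R, 1 < a -> 1 < b -> a <= a' -> (p a' b <= p a b)%E) /\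
   (forall a b b' : R, 1 < a -> 1 < b -> b <= b' -> (p a b <= p a b')%E)) /\
  ((forall a a' b : R, 0 < a -> a' < 1 -> 0 < b < 1 -> a <= a' ->
      (q a b <= q a' b)%E) /\
   (forall a b b' : R, 0 < a < 1 -> 0 < b -> b' < 1 -> b <= b' ->
      (q a b' <= q a b)%E)).
Proof.
move=> p q.
(* The laws make [Beta_fun] positive, which identifies the modes with the critical points. *)
have p_le (a b a' b' : R) : 1 < a -> 1 < b -> 1 < a' -> 1 < b' ->
    Beta_shift a b (Beta_crit a b) a' b' (Beta_crit a' b') ->
    (p a b <= p a' b')%E.
  move=> a1 b1 a'1 b'1.
  have law (u v : R) : 1 < u -> 1 < v -> has_Beta_law (X u v) u v.
    by move=> u1 v1; apply: hX; exact: lt_trans ltr01 _.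
  have B0 (u v : R) : 1 < u -> 1 < v -> 0 < Beta_fun u v.
    by move=> u1 v1; have [] := Beta_law_Beta_fun (law u v u1 v1).
  rewrite /p !Beta_modeE ?B0//.
  by apply: Beta_shift_tail_le; [exact: law|exact: law|
    exact: Beta_crit_gt1|exact: Beta_crit_gt1].
have q_le (a b a' b' : R) : 0 < a < 1 -> 0 < b < 1 -> 0 < a' < 1 -> 0 < b' < 1 ->
    Beta_shift a b (Beta_crit a b) a' b' (Beta_crit a' b') ->
    (q a b <= q a' b')%E.
  move=> /andP[a0 a1] /andP[b0 b1] /andP[a'0 a'1] /andP[b'0 b'1].
  have B0 (u v : R) : 0 < u -> 0 < v -> 0 < Beta_fun u v.
    by move=> u0 v0; have [] := Beta_law_Beta_fun (hX u v u0 v0).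
  rewrite /q !Beta_antimodeE ?B0//.
  by apply: Beta_shift_tail_le; [exact: hX|exact: hX|
    exact: Beta_crit_lt1|exact: Beta_crit_lt1].
split; split.
- move=> a a' b a1 b1 aa'; have a'1 := lt_le_trans a1 aa'.
  by apply: p_le => //; exact: Beta_shift_mode.
- move=> a b b' a1 b1 bb'; have b'1 := lt_le_trans b1 bb'.
  (* The case of the first parameter, with [a] and [b] exchanged, is reflected; critical points
     match through [1 - Beta_crit b a = Beta_crit a b]. *)
  apply: p_le => //; have := Beta_shift_onem (Beta_shift_mode b1 bb' a1).
  by rewrite !onem_Beta_crit// gt_eqF//; lra.
- move=> a a' b a0 a'1 b01 aa'.
  apply: q_le => //; [by lra|by lra|].
  by apply: Beta_shift_antimode => //; case/andP: b01.
- move=> a b b' a01 b0 b'1 bb'.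
  have /andP[a0 a1] := a01.
  apply: q_le => //; [by lra|by lra|].
  have := Beta_shift_onem (Beta_shift_antimode bb' b'1 a1).
  by rewrite !onem_Beta_crit// lt_eqF//; lra.
Qed.
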